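(* Every self-dual antinorm $f$ on $\mathbb{R}^2_+$ is obtained as follows: there exist a unit vector $a\in\mathbb{R}^2_+$ and an antinorm $f_1$ on $K_1$ with $f_1(a)=1$ and $f_1(x)\le (a,x)$ for all $x\in K_1$, such that $$f(x)=f_1(x)\ \text{ for } x\in K_1,\qquad f(y)=\inf_{x\in K_1}\frac{(y,x)}{f_1(x)}\ \text{ for } y\in K_2,$$ where $K_1$ is the closed angle between the ray $\{ta: t\ge 0\}$ and the nonnegative $x_1$-axis, and $K_2$ is the closed angle between the ray $\{ta: t\ge 0\}$ and the nonnegative $x_2$-axis.
   Context: $(\cdot,\cdot)$ is the standard inner product. An antinorm on a closed convex cone $K$ is a concave, nonnegative, somewhere positive function $f:K\to\mathbb{R}_+$ with $f(\lambda x)=\lambda f(x)$ for $\lambda\ge 0$; all antinorms are assumed continuous on $K$. In every infimum of a quotient $\frac{(y,x)}{f(x)}$, only points $x$ with $f(x)\neq 0$ are considered. The dual of an antinorm $f$ on $\mathbb{R}^2_+$ is $f^*(y)=\inf_{x\in\mathbb{R}^2_+}\frac{(y,x)}{f(x)}$; $f$ is self-dual if $f^*=f$. If $a$ lies on a coordinate axis, one of the angles $K_1,K_2$ degenerates to the ray $\{ta:t\ge0\}$. *)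

(* Defs.v *)
From HB Require Import structures.
From mathcomp Require Import all_boot all_order all_algebra.
From mathcomp Require Import all_classical all_reals all_analysis.

Set Implicit Arguments.
Unset Strict Implicit.
Unset Printing Implicit Defensive.

Import Order.TTheory GRing.Theory Num.Theory.
Import numFieldNormedType.Exports.

Local Open Scope classical_set_scope.
Local Open Scope ring_scope.

Definition dotp (R : realType) (n : nat) (y x : 'rV[R]_n) : R :=
  \sum_(i < n) y 0 i * x 0 i.

(* The norm `|x| of 'rV[R]_n in the library is the sup norm. *)
Definition enorm (R : realType) (n : nat) (x : 'rV[R]_n) : R :=
  Num.sqrt (dotp x x).

Record closed_convex_cone (R : realType) (n : nat) (K : set 'rV[R]_n) : Prop := {
  cone_closed : closed K;
  cone_convex : @convex_set R 'rV[R]_n K;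
  cone_scale : forall (t : R) (x : 'rV[R]_n), 0 <= t -> K x -> K (t *: x)
}.

(* A function on K is a total function whose values outside K are irrelevant:
   every clause only involves points of K, and continuity is for the subspace
   topology of K. *)
Record antinorm (R : realType) (n : nat) (K : set 'rV[R]_n)
    (f : 'rV[R]_n -> R) : Prop := {
  antinorm_cone : closed_convex_cone K;
  antinorm_concave : @convex_function R 'rV[R]_n K (fun x => - f x);
  antinorm_ge0 : forall x : 'rV[R]_n, K x -> 0 <= f x;
  antinorm_gt0 : exists2 x : 'rV[R]_n, K x & 0 < f x;
  antinorm_homo : forall (t : R) (x : 'rV[R]_n),
    0 <= t -> K x -> f (t *: x) = t * f x;
  antinorm_continuous : {within K, continuous f}
}.

(* The infimum is real-valued.  For an antinorm f on K and (y, x) >= 0 on K it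
   is taken over a nonempty set bounded below by 0. *)
Definition antinorm_dual (R : realType) (n : nat) (K : set 'rV[R]_n)
    (f : 'rV[R]_n -> R) (y : 'rV[R]_n) : R :=
  inf [set dotp y x / f x | x in [set x | K x /\ f x != 0]].

Definition orthant (R : realType) (n : nat) : set 'rV[R]_n :=
  [set x | forall i, 0 <= x 0 i].

Definition self_dual_antinorm (R : realType) (f : 'rV[R]_2 -> R) : Prop :=
  antinorm (@orthant R 2) f /\
  forall y : 'rV[R]_2, orthant y -> antinorm_dual (@orthant R 2) f y = f y.

(* The closed angle between the rays spanned by u and v (for an angle less
   than pi); it is the ray spanned by u when v is a positive multiple of u. *)
Definition angle (R : realType) (u v : 'rV[R]_2) : set 'rV[R]_2 :=
  [set x | exists s t : R, [/\ 0 <= s, 0 <= t & x = s *: u + t *: v]].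

Definition axis (R : realType) (i : 'I_2) : 'rV[R]_2 := delta_mx 0 i.

(* Main.v *)
(* Let a maximize f on the unit sphere of the orthant.  By concavity
   f(x) <= f(a) (a, x), so self-duality at a gives f(a) >= 1 / f(a); together
   with f(a)^2 <= (a, a) = 1 this yields f(a) = 1 and f(x) <= (a, x).  Take for
   f1 the restriction of f to K1.  If x and y lie both in K2, then
   (y, a) f(x) <= (y, a) (a, x) <= (y, x), so in the infimum defining f*(y) the
   points of K2 can be replaced with the single point a of K1. *)
Require Import Defs.
From mathcomp Require Import all_boot all_order all_algebra.
From mathcomp Require Import all_classical all_reals all_analysis.
From mathcomp Require Import ring lra.
Set Implicit Arguments.
Unset Strict Implicit.
Unset Printing Implicit Defensive.

Import Order.TTheory GRing.Theory Num.Theory.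
Import numFieldNormedType.Exports.
Local Open Scope classical_set_scope.
Local Open Scope ring_scope.

(** * Euclidean inner product *)

Section InnerProduct.
Variables (R : realType) (n : nat).
Implicit Types x y z : 'rV[R]_n.

Lemma dotpC x y : dotp x y = dotp y x.
Proof. by apply: eq_bigr => i _; rewrite mulrC. Qed.

Lemma dotpDr x y z : dotp x (y + z) = dotp x y + dotp x z.
Proof. by rewrite -big_split; apply: eq_bigr => i _; rewrite mxE mulrDr. Qed.

Lemma dotpZr t x y : dotp x (t *: y) = t * dotp x y.
Proof. by rewrite mulr_sumr; apply: eq_bigr => i _; rewrite mxE mulrCA. Qed.

Lemma dotpDl x y z : dotp (x + y) z = dotp x z + dotp y z.
Proof. by rewrite dotpC dotpDr !(dotpC z). Qed.

Lemma dotpZl t x y : dotp (t *: x) y = t * dotp x y.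
Proof. by rewrite dotpC dotpZr dotpC. Qed.

Lemma dotp_ge0 x : 0 <= dotp x x.
Proof. by apply: sumr_ge0 => i _; rewrite -expr2 sqr_ge0. Qed.

Lemma sqr_coord_le_dotp x i : x 0 i ^+ 2 <= dotp x x.
Proof.
rewrite /dotp (bigD1 i)//= -expr2 lerDl.
by apply: sumr_ge0 => j _; rewrite -expr2 sqr_ge0.
Qed.

Lemma dotp_gt0 x : x != 0 -> 0 < dotp x x.
Proof.
move=> x0; rewrite lt_def dotp_ge0 andbT; apply: contra x0 => /eqP xx0.
apply/eqP/rowP => i; rewrite mxE; apply/eqP.
by rewrite -sqrf_eq0 eq_le sqr_ge0 andbT -xx0 sqr_coord_le_dotp.
Qed.

Lemma dotp_orthant_ge0 x y : orthant x -> orthant y -> 0 <= dotp x y.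
Proof. by move=> ox oy; apply: sumr_ge0 => i _; rewrite mulr_ge0. Qed.

Lemma sqr_enorm x : enorm x ^+ 2 = dotp x x.
Proof. exact/sqr_sqrtr/dotp_ge0. Qed.

Lemma continuous_dotp_diag : continuous (fun x => dotp x x).
Proof.
apply: continuous_big; first exact: add_continuous.
by move=> i _ x; apply: continuousM; exact: coord_continuous.
Qed.

End InnerProduct.

(** * Antinorms on a cone and their maximizers *)

Section Antinorms.
Variables (R : realType) (n : nat).
Implicit Types (K : set 'rV[R]_n) (f : 'rV[R]_n -> R) (x y a : 'rV[R]_n).

(** [x + y] is the midpoint of [2 *: x] and [2 *: y]. *)
Lemma cone_addr K x y : closed_convex_cone K -> K x -> K y -> K (x + y).
Proof.
move=> [_ cK sK] Kx Ky.
have h0 : 0 <= 2^-1 :> R by rewrite invr_ge0.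
have h1 : 2^-1 <= 1 :> R by rewrite invf_le1 ?ler1n.
have := cK (2 *: x) (2 *: y) (Itv01 h0 h1).
rewrite !inE => /(_ (sK _ _ (ler0n _ 2) Kx) (sK _ _ (ler0n _ 2) Ky)).
congr K; rewrite /conv/= /unstable.onem !scalerA.
by rewrite (_ : 1 - 2^-1 = 2^-1); [rewrite mulVf ?pnatr_eq0// !scale1r|lra].
Qed.

Lemma antinorm_superadditive K f x y : antinorm K f -> K x -> K y ->
  f x + f y <= f (x + y).
Proof.
move=> fK Kx Ky; have sK := cone_scale (antinorm_cone fK).
have h0 : 0 <= 2^-1 :> R by rewrite invr_ge0.
have h1 : 2^-1 <= 1 :> R by rewrite invf_le1 ?ler1n.
have /(_ (2 *: x) (2 *: y)) := antinorm_concave fK (Itv01 h0 h1).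
rewrite !inE => /(_ (sK _ _ (ler0n _ 2) Kx) (sK _ _ (ler0n _ 2) Ky)).
rewrite /conv/= /conv/= /unstable.onem !scalerA (_ : 1 - 2^-1 = 2^-1); last lra.
rewrite mulVf ?pnatr_eq0// !scale1r !(antinorm_homo fK)//.
rewrite /GRing.scale/=; lra.
Qed.

(** Positivity somewhere is the one clause on [f] that restriction can lose, hence its separate
    hypothesis. *)
Lemma sub_antinorm K K' f : antinorm K f -> closed_convex_cone K' ->
  K' `<=` K -> (exists2 x, K' x & 0 < f x) -> antinorm K' f.
Proof.
move=> [_ cf f0 _ hf ctf] cK' K'K pf; split => //.
- by move=> t x y; rewrite !inE => /K'K Kx /K'K Ky; apply: cf; rewrite inE.
- by move=> x /K'K; apply: f0.
- by move=> t x t0 /K'K; apply: hf.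
- exact: continuous_subspaceW ctf.
Qed.

(* At a maximizer of f / enorm, the superlevel set [f a <= f] has a as the
   point closest to the origin, so it lies in the half-space 1 <= (a, x). *)
Lemma antinorm_maximizer_support K f a : antinorm K f -> K a ->
  dotp a a = 1 -> (forall x, K x -> f x <= f a * enorm x) ->
  forall x, K x -> f x <= f a * dotp a x.
Proof.
move=> fK Ka aa fmax x Kx; have [cK fge0] := (antinorm_cone fK, antinorm_ge0 fK).
set m := f a; rewrite leNgt; apply/negP => lt_f.
have m0 : 0 <= m by exact: fge0.
have fx0 := fge0 _ Kx.
have m_gt0 : 0 < m.
  rewrite lt_def m0 andbT; apply/eqP => m_eq0.
  have := fmax x Kx; rewrite -/m m_eq0 mul0r => f0.
  by move: lt_f; rewrite m_eq0 mul0r ltNge f0.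
set d := f x - m * dotp a x; have d0 : 0 < d by rewrite subr_gt0.
(* Compare maximality at [a + t *: x] with superadditivity: after squaring, the terms constant in
   [t] cancel, so a violation [d > 0], linear in [t], is bounded by a quadratic term. *)
have bound t : 0 <= t -> 2 * (t * d) <= t ^+ 2 * (m * dotp x x).
  move=> t0; have Ktx := cone_scale cK t0 Kx.
  have := fmax _ (cone_addr cK Ka Ktx).
  have := antinorm_superadditive fK Ka Ktx.
  rewrite (antinorm_homo fK)// => /le_trans/[apply] le1.
  have le2 : (m + t * f x) ^+ 2 <= (m * enorm (a + t *: x)) ^+ 2.
    rewrite ler_sqr ?nnegrE//; first by rewrite addr_ge0// mulr_ge0.
    by rewrite mulr_ge0// sqrtr_ge0.
  move: le2; rewrite exprMn sqr_enorm !(dotpDl, dotpDr, dotpZl, dotpZr) aa.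
  rewrite (dotpC x a) => le2; rewrite -(ler_pM2l m_gt0) /d.
  have : 0 <= (t * f x) ^+ 2 by exact: sqr_ge0.
  lra.
have q0 := dotp_ge0 x.
set c := m * dotp x x; have c0 : 0 <= c by rewrite mulr_ge0.
(* Small enough to contradict [bound], which becomes [2 * t ^+ 2 * (c + 1) <= t ^+ 2 * c]; the [+ 1]
   keeps the denominator positive. *)
have t0 : 0 < d / (c + 1) by rewrite divr_gt0// ltr_wpDl.
have := bound _ (ltW t0); rewrite -/c.
set t := d / (c + 1) in t0 *.
have -> : d = t * (c + 1) by rewrite /t divfK// gt_eqF// ltr_wpDl.
have t2_gt0 : 0 < t ^+ 2 by rewrite exprn_gt0.
by have := mulr_ge0 (ltW t2_gt0) c0; lra.
Qed.

End Antinorms.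

(** * Compactness and existence of a maximizer *)

Lemma closed_orthant (R : realType) (n : nat) : closed (@orthant R n).
Proof.
rewrite (_ : orthant (n:=n) =
    \bigcap_(i in setT) ((fun x : 'rV[R]_n => x 0 i) @^-1` [set z | 0 <= z])).
  apply: closed_bigI => i _; apply: preimage_closed; last exact: closed_ge.
  by move=> x _; exact: coord_continuous.
by apply/seteqP; split=> [x ox i _|x ox i]; [exact: ox|exact: (ox i)].
Qed.

(** It is a closed subset of the cube with sides [[0, 1]]. *)
Lemma orthant_sphere_compact (R : realType) (n : nat) :
  compact (@orthant R n `&` [set x | dotp x x = 1]).
Proof.
apply: (@subclosed_compact _ _
  [set x : 'rV[R]_n | forall i, `[0, 1]%classic (x ord0 i)]).
- apply: closedI; first exact: closed_orthant.
  apply: (preimage_closed (D := [set 1 : R])); last exact: closed_eq.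
  by move=> x _; exact: continuous_dotp_diag.
- by apply: (@rV_compact R n (fun=> `[0, 1]%classic)) => i; exact: segment_compact.
- move=> x [ox xx] i /=; rewrite in_itv/= ox/=.
  by rewrite -(@expr_le1 _ 2)// -xx sqr_coord_le_dotp.
Qed.

(** The maximum on the compact spherical part of the orthant extends to all of it by homogeneity. *)
Lemma antinorm_maximizer (R : realType) (n : nat) (f : 'rV[R]_n -> R) :
  antinorm (@orthant R n) f ->
  exists a, [/\ orthant a, dotp a a = 1, 0 < f a &
    forall x, orthant x -> f x <= f a * enorm x].
Proof.
move=> fK.
have normalize x : orthant x -> x != 0 ->
    (@orthant R n `&` [set x | dotp x x = 1]) ((enorm x)^-1 *: x).
  move=> ox x0; split.
    by apply: (cone_scale (antinorm_cone fK)) => //; rewrite invr_ge0 sqrtr_ge0.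
  rewrite /= dotpZl dotpZr -sqr_enorm; field.
  by rewrite sqrtr_eq0 -ltNge dotp_gt0.
have enorm_gt0 (x : 'rV[R]_n) : x != 0 -> 0 < enorm x.
  by move=> x0; rewrite sqrtr_gt0 dotp_gt0.
have f0 : f 0 = 0.
  have o0 : orthant (0 : 'rV[R]_n) by move=> i; rewrite mxE.
  by have := antinorm_homo fK (lexx 0) o0; rewrite scale0r mul0r.
have [x ox fx] := antinorm_gt0 fK.
have x0 : x != 0 by apply: contraTneq fx => ->; rewrite f0 ltxx.
have [||a] := compact_EVT_max _ (@orthant_sphere_compact R n) (f := f).
- by exists ((enorm x)^-1 *: x); exact: normalize.
- by apply: continuous_subspaceW (antinorm_continuous fK) => y [].
rewrite inE => -[oa aa] amax.
have fmax y : orthant y -> f y <= f a * enorm y.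
  move=> oy; have [->|y0] := eqVneq y 0.
    by rewrite f0 mulr_ge0 ?sqrtr_ge0// (antinorm_ge0 fK).
  have := amax _ (mem_set (normalize y oy y0)).
  rewrite (antinorm_homo fK) ?invr_ge0 ?sqrtr_ge0//.
  by rewrite ler_pdivrMl ?enorm_gt0// mulrC.
exists a; split=> //.
by rewrite -(pmulr_lgt0 _ (enorm_gt0 _ x0)) (lt_le_trans fx)// fmax.
Qed.

(** * Division-free bounds for the dual *)

Lemma le_antinorm_dual (R : realType) (n : nat) (K : set 'rV[R]_n)
    (f : 'rV[R]_n -> R) (y : 'rV[R]_n) (m : R) :
  antinorm K f -> (forall x, K x -> m * f x <= dotp y x) ->
  m <= antinorm_dual K f y.
Proof.
move=> fK mf; apply: lb_le_inf.
  (* A point with [f x > 0] makes the set of quotients nonempty, so [inf] is a true infimum. *)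
  have [x Kx fx] := antinorm_gt0 fK.
  by exists (dotp y x / f x); exists x => //; split=> //; rewrite gt_eqF.
move=> _ [x [Kx fx0] <-].
by rewrite ler_pdivlMr ?mf// lt_def fx0 (antinorm_ge0 fK).
Qed.

Lemma antinorm_dual_le (R : realType) (n : nat) (K : set 'rV[R]_n)
    (f : 'rV[R]_n -> R) (y x : 'rV[R]_n) :
  antinorm K f -> (forall z, K z -> 0 <= dotp y z) ->
  K x -> antinorm_dual K f y * f x <= dotp y x.
Proof.
move=> fK y0 Kx; have [->|fx0] := eqVneq (f x) 0; first by rewrite mulr0 y0.
rewrite -ler_pdivlMr; last by rewrite lt_def fx0 (antinorm_ge0 fK).
apply: ge_inf; last by exists x.
exists 0 => _ [z [Kz fz0] <-].
by rewrite divr_ge0 ?y0// (antinorm_ge0 fK).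
Qed.

Lemma self_dual_contact (R : realType) (f : 'rV[R]_2 -> R) :
  self_dual_antinorm f ->
  exists a, [/\ orthant a, dotp a a = 1, f a = 1 &
    forall x, orthant x -> f x <= dotp a x].
Proof.
move=> [fK fd].
have prod_le x y : orthant x -> orthant y -> f y * f x <= dotp y x.
  move=> ox oy; rewrite -[f y]fd//; apply: antinorm_dual_le => // z oz.
  exact: dotp_orthant_ge0.
have [a [oa aa fa0 fmax]] := antinorm_maximizer fK.
have supp := antinorm_maximizer_support fK oa aa fmax.
have fa1 : f a = 1.
  have fa_le1 : f a <= 1.
    by rewrite -(@expr_le1 _ 2) ?(ltW fa0)// -aa prod_le.
  (* By [supp], [(f a)^-1] is a lower bound of the quotients defining the dual at [a], which equals
     [f a]. *)
  apply/eqP; rewrite eq_le fa_le1 /= -(invf_le1 fa0) (le_trans _ fa_le1)//.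
  rewrite -{2}fd//; apply: le_antinorm_dual => // x ox.
  by rewrite ler_pdivrMl// supp.
by exists a; split=> // x ox; rewrite -[dotp _ _]mul1r -fa1 supp.
Qed.

(** * Angles in the plane quadrant *)

Section PlaneAngles.
Variable R : realType.
Implicit Types a x y : 'rV[R]_2.

Lemma dotpE2 x y : dotp x y = x 0 0 * y 0 0 + x 0 1 * y 0 1.
Proof.
rewrite /dotp !big_ord_recl big_ord0 addr0.
by rewrite (_ : lift ord0 ord0 = 1)//; apply/val_inj.
Qed.

Lemma forall_ord2 (P : 'I_2 -> Prop) : P 0 -> P 1 -> forall i, P i.
Proof.
move=> P0 P1; case=> [[|[|//]]] lt_i.
- by rewrite (_ : Ordinal lt_i = 0)//; exact: val_inj.
- by rewrite (_ : Ordinal lt_i = 1)//; exact: val_inj.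
Qed.

Lemma row2P x y : x 0 0 = y 0 0 -> x 0 1 = y 0 1 -> x = y.
Proof. by move=> e0 e1; apply/rowP; exact: forall_ord2. Qed.

Lemma orthant2P x : orthant x <-> 0 <= x 0 0 /\ 0 <= x 0 1.
Proof. by split=> [ox|[x0 x1]]; [split; exact: ox|exact: forall_ord2]. Qed.

(* The angle is the part of the quadrant on one side of the line through a;
   this form also covers the degenerate case where it is a ray. *)
Lemma angle_axis0P a x : orthant a -> dotp a a = 1 ->
  angle a (axis R 0) x <-> orthant x /\ a 0 0 * x 0 1 <= a 0 1 * x 0 0.
Proof.
rewrite !orthant2P dotpE2 => -[a0 a1] aa; split.
  move=> [s [t [s0 t0 ->]]]; rewrite !mxE/= mulr0 addr0 mulr1.
  by do 2?split; nra.
move=> [[x0 x1] le_x]; have [a1_eq0|a1_neq0] := eqVneq (a 0 1) 0.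
  (* Here [a] lies on the first axis, and [le_x] forces [x 0 1 = 0]. *)
  have a0_gt0 : 0 < a 0 0 by rewrite lt_def a0 andbT; apply/eqP => a0_eq0; nra.
  exists 0, (x 0 0); split=> //; apply: row2P; rewrite !mxE/=; nra.
have a1_gt0 : 0 < a 0 1 by rewrite lt_def a1_neq0.
(* The second coordinate determines [s]; the side condition is then [0 <= t]. *)
exists (x 0 1 / a 0 1), (x 0 0 - x 0 1 / a 0 1 * a 0 0); split.
- by rewrite divr_ge0.
- by rewrite subr_ge0 mulrAC ler_pdivrMr// mulrC [leRHS]mulrC.
- by apply: row2P; rewrite !mxE/=; field.
Qed.

Lemma angle_axis1_sub a x : orthant a -> angle a (axis R 1) x ->
  orthant x /\ a 0 1 * x 0 0 <= a 0 0 * x 0 1.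
Proof.
rewrite !orthant2P => -[a0 a1] [s [t [s0 t0 ->]]].
rewrite !mxE/= mulr0 addr0 mulr1.
by do 2?split; nra.
Qed.

(** Closedness comes from the half-plane description, convexity and scaling from the generators. *)
Lemma angle_axis0_cone a : orthant a -> dotp a a = 1 ->
  closed_convex_cone (angle a (axis R 0)).
Proof.
move=> oa aa.
have angleE : angle a (axis R 0) =
    @orthant R 2 `&`
    (fun x : 'rV[R]_2 => a 0 1 * x 0 0 - a 0 0 * x 0 1) @^-1` [set z | 0 <= z].
  apply/seteqP; split=> x; rewrite angle_axis0P//= => -[ox le_x].
    by split=> //=; rewrite subr_ge0.
  by split=> //; rewrite -subr_ge0.
split.
- rewrite angleE; apply: closedI; first exact: closed_orthant.
  apply: preimage_closed; last exact: closed_ge.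
  have ctC (c : R) i : continuous (fun x : 'rV[R]_2 => c * x 0 i).
    move=> x; apply: continuousM; [exact: cst_continuous|exact: coord_continuous].
  by move=> x _; exact: (continuousB (ctC _ _ x) (ctC _ _ x)).
- move=> x y l; rewrite !inE => -[s [t [s0 t0 ->]]] [s' [t' [s'0 t'0 ->]]].
  exists (l%:num * s + (1 - l%:num) * s'), (l%:num * t + (1 - l%:num) * t').
  have l0 : 0 <= l%:num by [].
  have l1 : 0 <= 1 - l%:num by rewrite subr_ge0.
  split; [by rewrite addr_ge0// mulr_ge0|by rewrite addr_ge0// mulr_ge0|].
  by rewrite /conv/= /unstable.onem !scalerDr !scalerA addrACA -!scalerDl.
- move=> c x c0 [s [t [s0 t0 ->]]]; exists (c * s), (c * t).
  by split; rewrite ?mulr_ge0// scalerDr !scalerA.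
Qed.

(* The right-hand side minus the left-hand side is the product of the
   components of x and y orthogonal to a. *)
Lemma dotp_same_side a x y : dotp a a = 1 ->
  a 0 1 * x 0 0 <= a 0 0 * x 0 1 -> a 0 1 * y 0 0 <= a 0 0 * y 0 1 ->
  dotp y a * dotp a x <= dotp y x.
Proof.
rewrite !dotpE2 -!(subr_ge0 (_ * _ 0 0)) => aa x0 y0.
(* Inserting [dotp a a] for [1] turns the difference into Lagrange's identity. *)
rewrite -subr_ge0 -[X in _ <= X - _]mul1r -[X in _ <= X * _ - _]aa.
have := mulr_ge0 x0 y0; lra.
Qed.

End PlaneAngles.

(** * Recovering the antinorm from one angle *)

Theorem theorem3 (R : realType) (f : 'rV[R]_2 -> R)
    (hf : self_dual_antinorm f) :
  exists (a : 'rV[R]_2) (f1 : 'rV[R]_2 -> R),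
    let K1 := angle a (axis R 0) in
    let K2 := angle a (axis R 1) in
    [/\ orthant a /\ enorm a = 1,
        antinorm K1 f1,
        f1 a = 1 /\ (forall x : 'rV[R]_2, K1 x -> f1 x <= dotp a x),
        forall x : 'rV[R]_2, K1 x -> f x = f1 x
      & forall y : 'rV[R]_2, K2 y -> f y = antinorm_dual K1 f1 y].
Proof.
have [a [oa aa fa1 fle]] := self_dual_contact hf.
have [fK fd] := hf.
exists a, f => K1 K2.
have K1a : K1 a by exists 1, 0; rewrite scale1r scale0r addr0.
have K1o x : K1 x -> orthant x by move/(angle_axis0P _ oa aa) => -[].
have fK1 : antinorm K1 f.
  apply: (sub_antinorm fK) => //.
    exact: angle_axis0_cone.
  by exists a; rewrite // fa1.
split=> //.
- by rewrite /enorm aa sqrtr1.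
- by split=> // x /K1o/fle.
move=> y /(angle_axis1_sub oa)[oy side_y].
have dual_le x : K1 x -> antinorm_dual K1 f y * f x <= dotp y x.
  by apply: antinorm_dual_le => // z /K1o; exact: dotp_orthant_ge0.
apply/eqP; rewrite eq_le; apply/andP; split.
  (* The infimum over [K1] runs over fewer points than that over the orthant. *)
  apply: le_antinorm_dual => // x /K1o ox; rewrite -[f y]fd//.
  by apply: antinorm_dual_le => // z; exact: dotp_orthant_ge0.
rewrite -[f y]fd//; apply: le_antinorm_dual => // x ox.
(* Either [x] is in [K1], or it lies on the same side of [a] as [y] and is replaced by [a]. *)
have [le_x|/ltW le_x] := leP (a 0 0 * x 0 1) (a 0 1 * x 0 0).
  exact/dual_le/angle_axis0P.
apply: le_trans (dotp_same_side aa le_x side_y).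
have := dual_le _ K1a; rewrite fa1 mulr1 => dual_le_a.
apply: (@le_trans _ _ (dotp y a * f x)).
  by rewrite ler_wpM2r// (antinorm_ge0 fK).
by rewrite ler_wpM2l ?fle// dotp_orthant_ge0.
Qed.
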